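(* Let $n$ be a positive integer with $n\equiv 1\pmod 4$. Then, modulo $\Phi_n(q)$, \[ \sum_{k=0}^{(n-1)/2}\frac{(q;q^2)_k^2(q^2;q^4)_k}{(q^2;q^2)_k^2(q^4;q^4)_k}\,(-q)^k \equiv\begin{cases} \dfrac{(q,q^2;q^4)_{(n-1)/8}^2\,(-q;q)_{(n-1)/2}}{(q^4;q^4)_{(n-1)/4}^2}\,q^{-(1-n)^2/4} &\text{if } n\equiv 1\pmod 8,\\[8pt] 0 &\text{if } n\equiv 5\pmod 8. \end{cases} \]
   Context: For an indeterminate $a$ and a nonnegative integer $k$, $(a;q)_k=\prod_{j=0}^{k-1}(1-aq^j)$, with $(a;q)_0=1$, and $(a_1,\dots,a_m;q)_k=(a_1;q)_k\cdots(a_m;q)_k$. $\Phi_n(q)=\prod_{1\le j\le n,\ \gcd(j,n)=1}(q-e^{2\pi i j/n})$ is the $n$-th cyclotomic polynomial. A congruence between rational functions in $q$ (possibly involving negative powers of $q$) modulo a polynomial $P(q)$ means that the difference, written as a ratio of polynomials with denominator coprime to $P(q)$, has numerator divisible by $P(q)$. *)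

(* Defs.v *)
From HB Require Import structures.
From mathcomp Require Import all_boot all_order all_algebra all_field.
Set Implicit Arguments. Unset Strict Implicit. Unset Printing Implicit Defensive.
Import GRing.Theory Num.Theory.
Local Open Scope ring_scope.

Definition RF := {fraction {poly rat}}.

Definition tof (p : {poly rat}) : RF := @FracField.tofrac _ p.

Definition qq : RF := tof 'X.

Definition qpoch (F : comRingType) (a p : F) (k : nat) : F :=
  \prod_(j < k) (1 - a * p ^+ j).

Definition PhiQ (n : nat) : {poly rat} := map_poly (intr : int -> rat) ('Phi_n).

Definition eqmodPhi (n : nat) (x y : RF) : Prop :=
  exists (N D : {poly rat}),
    [/\ D != 0, coprimep D (PhiQ n), PhiQ n %| N & x - y = tof N / tof D].

(* Main.v *)
Require Import Defs.
From HB Require Import structures.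
From mathcomp Require Import all_boot all_order all_algebra all_field.
From mathcomp Require Import ring zify.
Import GRing.Theory Num.Theory.
Local Open Scope ring_scope.
Set Implicit Arguments. Unset Strict Implicit. Unset Printing Implicit Defensive.

(** A congruence modulo [Phi_n] is an equality of values at a primitive [n]-th
    root of unity [z].  As [n] is odd, write [z = u^2] with [u] primitive, and
    let [t_k] be the summand at [z] and [n = 4 M + 1].  Reversing the sum gives
    [t_(2M-k) = t_k u^(4k+1)], so twice the sum is [\sum_k (1 + u^(4k+1)) t_k].
    Contrary to the original sum, this one has a deformation that is summable
    for generic [q]: with [x = q^(2n)] (so [x = 1] at [q = u]), the terminating
    sum of
      [(1 + q^(4k+1)) (q^4; q^8)_k (q^2/x, q^2 x; q^4)_k
         / ((q^8; q^8)_k (q^4/x, q^4 x; q^4)_k) (- q^2)^k]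
    satisfies a first-order recurrence in [M], with a rational WZ certificate,
    and is therefore an explicit product.  Specializing [q] to [u] kills the
    product when [n = 5 mod 8]; when [n = 1 mod 8] the factor [1 - q^n] cancels
    and reflecting exponents [i -> n - i] yields
    [(z^2; z^4)_r^2 / (z^4; z^4)_r^2] with [r = (n - 1) / 8], which is the value
    of the right-hand side at [z]. *)

(** * A WZ pair *)

Section WZ.
Variables (F : fieldType) (q : F).

(** The quotient [(q^4; q^8)_k (q^2/x, q^2 x; q^4)_k / ((q^8; q^8)_k (q^4/x, q^4 x; q^4)_k)], with
    each factor [1 - q^i/x] multiplied by [x], above and below. *)
Definition wprod (x : F) (k : nat) : F :=
  \prod_(j < k) ((1 - q ^+ (8 * j + 4)) * (x - q ^+ (4 * j + 2))
                 * (1 - x * q ^+ (4 * j + 2))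
                 / ((1 - q ^+ (8 * j + 8)) * (x - q ^+ (4 * j + 4))
                    * (1 - x * q ^+ (4 * j + 4)))).

Definition wterm (x : F) (k : nat) : F :=
  (1 + q ^+ (4 * k + 1)) * wprod x k * (- q ^+ 2) ^+ k.

Hypotheses (q_neq0 : q != 0) (q_inf : forall i, (0 < i)%N -> q ^+ i != 1).

Lemma one_sub_qX i : (0 < i)%N -> 1 - q ^+ i != 0.
Proof. by move=> i_gt0; rewrite subr_eq0 eq_sym q_inf. Qed.

Lemma qX_sub_qX i j : i != j -> q ^+ i - q ^+ j != 0.
Proof.
wlog lt_ij : i j / (i < j)%N => [hw ne_ij|_].
  case: (ltngtP i j) (ne_ij) => // lt_ij _; first exact: hw.
  by rewrite -oppr_eq0 opprB hw // eq_sym.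
rewrite -(subnKC (ltnW lt_ij)) exprD -{1}[q ^+ i]mulr1 -mulrBr.
by rewrite mulf_neq0 ?expf_neq0 // one_sub_qX // subn_gt0.
Qed.

Lemma wprodS x k : wprod x k.+1 = wprod x k *
  ((1 - q ^+ 4 * (q ^+ (4 * k)) ^+ 2) * (x - q ^+ 2 * q ^+ (4 * k))
      * (1 - x * (q ^+ 2 * q ^+ (4 * k)))
     / ((1 - q ^+ 8 * (q ^+ (4 * k)) ^+ 2) * (x - q ^+ 4 * q ^+ (4 * k))
      * (1 - x * (q ^+ 4 * q ^+ (4 * k))))).
Proof.
rewrite /wprod big_ord_recr /= -!exprM -!exprD.
by do ![congr (_ * _) | congr (_ - _) | congr (_ ^-1) | congr (_ ^+ _)]; lia.
Qed.

Lemma wprod_eq0 M k : (2 * M < k)%N -> wprod (q ^+ (8 * M + 2)) k = 0.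
Proof.
move=> lt_k; rewrite /wprod (bigD1 (Ordinal lt_k)) //=.
have -> : (4 * (2 * M) + 2 = 8 * M + 2)%N by lia.
by rewrite subrr mulr0 !mul0r.
Qed.

Ltac qneq := repeat (apply/andP; split);
  rewrite -?exprM -?exprD -?exprS;
  first [exact: q_neq0 | apply: one_sub_qX; lia | apply: qX_sub_qX; lia
         | rewrite -oppr_eq0 opprB; apply: one_sub_qX; lia].

(** Multiplying [x] by [q^8] moves the factorials in base [q^4] by two steps, so all but boundedly
    many factors cancel. The differences in the denominator are nonzero: the exponent of [x] is 2
    modulo 4, that of [y] is 0. *)
Lemma wprod_shift M k (x := q ^+ (8 * M + 2)) (y := q ^+ (4 * k)) :
  wprod x k = (1 - x) / (1 - q ^+ 8 * x) * wprod (q ^+ 8 * x) k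
       * (q ^+ 6 * x - y) * (q ^+ 2 * x - y)
       * (1 - q ^+ 4 * x * y) * (1 - q ^+ 8 * x * y)
        / ((1 - q ^+ 2 * x * y) * (1 - q ^+ 6 * x * y)
       * (q ^+ 4 * x - y) * (x - y)).
Proof.
rewrite {}/y; elim: k => [|k IHk].
  rewrite /wprod !big_ord0 muln0 expr0; field.
  by rewrite /x; qneq.
rewrite !wprodS {}IHk (_ : q ^+ (4 * k.+1) = q ^+ 4 * q ^+ (4 * k)); last first.
  by rewrite -exprD; congr (_ ^+ _); lia.
move: (wprod _ k) => p; field.
by rewrite /x; qneq.
Qed.

(* [g] is the certificate at [y = q^(4k)], [p] standing for [wprod (q^8 x) k],
   [p0] for [wprod x k] (see [wprod_shift]) and [s] for [(- q^2)^k].  The terms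
   at [x] are expressed through those at [q^8 x] and not conversely, because at
   the last two indices [wprod x k = 0] while [wprod (q^8 x) k <> 0]. *)
Lemma wz_field (x y p s : F) :
  q != 0 ->
  1 - q ^+ 8 * y ^+ 2 != 0 ->
  q ^+ 8 * x - q ^+ 4 * y != 0 ->
  1 - q ^+ 8 * x * (q ^+ 4 * y) != 0 ->
  x - y != 0 -> q ^+ 4 * x - y != 0 ->
  1 - q ^+ 2 * x * y != 0 -> 1 - q ^+ 6 * x * y != 0 ->
  1 - q ^+ 2 * x * (q ^+ 4 * y) != 0 -> 1 - q ^+ 6 * x * (q ^+ 4 * y) != 0 ->
  q ^+ 4 * x - q ^+ 4 * y != 0 ->
  1 - q ^+ 8 * x != 0 -> 1 - x != 0 ->
  let p0 := (1 - x) / (1 - q ^+ 8 * x) * p * (q ^+ 6 * x - y)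
       * (q ^+ 2 * x - y) * (1 - q ^+ 4 * x * y) * (1 - q ^+ 8 * x * y)
        / ((1 - q ^+ 2 * x * y) * (1 - q ^+ 6 * x * y)
       * (q ^+ 4 * x - y) * (x - y)) in
  let g p y s := - (p * s) / (1 - q ^+ 8 * x) * q ^+ 4 * x * (1 - q ^+ 2) * (1 - q ^+ 8 * x ^+ 2)
     * (1 - y / q) * (1 - y ^+ 2) * (1 - q ^+ 8 * x * y)
     / ((1 - q ^+ 2 * x * y) * (1 - q ^+ 6 * x * y) * (q ^+ 4 * x - y)) in
  (1 - q ^+ 5 * x) * (1 - q ^+ 7 * x) * (((1 + q * y) * p * s) / (1 - q ^+ 8 * x))
  - (1 - q * x) * (1 - q ^+ 3 * x) * (((1 + q * y) * p0 * s) / (1 - x))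
  = g (p * ((1 - q ^+ 4 * y ^+ 2) * (q ^+ 8 * x - q ^+ 2 * y) * (1 - q ^+ 8 * x * (q ^+ 2 * y))
     / ((1 - q ^+ 8 * y ^+ 2) * (q ^+ 8 * x - q ^+ 4 * y) * (1 - q ^+ 8 * x * (q ^+ 4 * y)))))
     (q ^+ 4 * y) (- q ^+ 2 * s) - g p y s.
Proof.
cbv beta zeta; intros.
field.
by repeat (apply/andP; split).
Qed.

Definition wsum M := \sum_(k < 2 * M + 1) wterm (q ^+ (8 * M + 2)) k.

Lemma wsum_widen M N : (2 * M + 1 <= N)%N ->
  \sum_(k < N) wterm (q ^+ (8 * M + 2)) k = wsum M.
Proof.
move=> le_N; rewrite -(subnKC le_N) big_split_ord /= [X in _ + X]big1 ?addr0 //.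
by move=> i _; rewrite /wterm wprod_eq0 ?mulr0 ?mul0r // ltn_addr // addn1.
Qed.

Lemma wsumS M (x := q ^+ (8 * M + 2)) :
  (1 - q ^+ 5 * x) * (1 - q ^+ 7 * x) * (wsum M.+1 / (1 - q ^+ 8 * x))
  = (1 - q * x) * (1 - q ^+ 3 * x) * (wsum M / (1 - x)).
Proof.
have xS : q ^+ (8 * M.+1 + 2) = q ^+ 8 * x.
  by rewrite /x -exprD; congr (_ ^+ _); lia.
pose g k := - (wprod (q ^+ 8 * x) k * (- q ^+ 2) ^+ k) / (1 - q ^+ 8 * x) * q ^+ 4 * x
     * (1 - q ^+ 2) * (1 - q ^+ 8 * x ^+ 2) * (1 - q ^+ (4 * k) / q)
     * (1 - (q ^+ (4 * k)) ^+ 2) * (1 - q ^+ 8 * x * q ^+ (4 * k))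
     / ((1 - q ^+ 2 * x * q ^+ (4 * k)) * (1 - q ^+ 6 * x * q ^+ (4 * k))
        * (q ^+ 4 * x - q ^+ (4 * k))).
have gS k : (1 - q ^+ 5 * x) * (1 - q ^+ 7 * x) * (wterm (q ^+ 8 * x) k / (1 - q ^+ 8 * x))
   - (1 - q * x) * (1 - q ^+ 3 * x) * (wterm x k / (1 - x)) = g k.+1 - g k.
  have yS : q ^+ (4 * k.+1) = q ^+ 4 * q ^+ (4 * k).
    by rewrite -exprD; congr (_ ^+ _); lia.
  rewrite /g /wterm addn1 (exprS q (4 * k)) wprod_shift wprodS yS (exprS _ k).
  by apply: wz_field; rewrite /x; qneq.
(* Both sums are taken over the longer range [k < 2 M + 3] before telescoping. *)
have le_N : (2 * M + 1 <= 2 * M.+1 + 1)%N by lia.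
rewrite -(wsum_widen le_N) /wsum xS; apply/eqP; rewrite -subr_eq0.
rewrite !mulr_suml !mulr_sumr -sumrB.
rewrite (eq_bigr (fun k : 'I__ => g k.+1 - g k)) => [|k _]; last exact: gS.
rewrite -(big_mkord xpredT (fun k => g k.+1 - g k)) telescope_sumr //.
(* The upper end vanishes because [wprod] terminates, the lower one by the factor [1 - y^2] at
   [y = 1]. *)
rewrite /g -xS wprod_eq0 ?addn1 // muln0 expr0 expr1n subrr.
by rewrite !(mul0r, mulr0, oppr0) addr0.
Qed.

(** By [wsumS], [wsum M / (1 - x)] has an explicit ratio of consecutive values; it starts at
    [1 / (1 - q)], since [wsum 0 = 1 + q]. *)
Lemma wsumE M :
  wsum M = (1 - q ^+ (8 * M + 2))
    * \prod_(i < M) ((1 - q ^+ (8 * i + 3)) * (1 - q ^+ (8 * i + 5)))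
    / (\prod_(i < M) (1 - q ^+ (8 * i + 7)) * \prod_(i < M.+1) (1 - q ^+ (8 * i + 1))).
Proof.
elim: M => [|M IHM].
  rewrite /wsum muln0 !add0n !big_ord1 !big_ord0 /wterm /wprod big_ord0.
  rewrite !muln0 !add0n expr0 expr1; field.
  by rewrite -{1}(expr1 q) one_sub_qX.
have := wsumS M; rewrite IHM (big_ord_recr M.+1) /=.
set C := \prod_(i < M.+1) (1 - q ^+ (8 * i + 1)).
rewrite !(big_ord_recr M) /=.
set A := \prod_(i < M) _; set B := \prod_(i < M) _.
have xS : q ^+ (8 * M.+1 + 2) = q ^+ 8 * q ^+ (8 * M + 2).
  by rewrite -exprD; congr (_ ^+ _); lia.
rewrite xS.
have -> : q ^+ (8 * M + 3) = q * q ^+ (8 * M + 2) by rewrite -exprS; congr (_ ^+ _); lia.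
have -> : q ^+ (8 * M + 5) = q ^+ 3 * q ^+ (8 * M + 2) by rewrite -exprD; congr (_ ^+ _); lia.
have -> : q ^+ (8 * M + 7) = q ^+ 5 * q ^+ (8 * M + 2) by rewrite -exprD; congr (_ ^+ _); lia.
have -> : q ^+ (8 * M.+1 + 1) = q ^+ 7 * q ^+ (8 * M + 2) by rewrite -exprD; congr (_ ^+ _); lia.
set x := q ^+ (8 * M + 2) => hS.
have B_neq0 : B != 0 by rewrite /B; apply/prodf_neq0 => i _; apply: one_sub_qX; lia.
have C_neq0 : C != 0 by rewrite /C; apply/prodf_neq0 => i _; apply: one_sub_qX; lia.
have d5 : 1 - q ^+ 5 * x != 0 by rewrite /x; qneq.
have d7 : 1 - q ^+ 7 * x != 0 by rewrite /x; qneq.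
have d8 : 1 - q ^+ 8 * x != 0 by rewrite /x; qneq.
have d0 : 1 - x != 0 by rewrite /x; qneq.
apply: (mulIf (mulf_neq0 (invr_neq0 d8) (mulf_neq0 d5 d7))).
transitivity ((1 - q ^+ 5 * x) * (1 - q ^+ 7 * x) * (wsum M.+1 / (1 - q ^+ 8 * x))); first by ring.
rewrite hS; field.
by rewrite d0 d5 d7 d8 B_neq0 C_neq0.
Qed.
End WZ.

(** * Specialization of rational functions *)

Section Specialization.
Variable w : algC.

Definition ev (p : {poly rat}) : algC := (map_poly ratr p).[w].

(* A relation, since an element of [RF] may have a pole at [w]. *)
Definition spec (x : RF) (v : algC) : Prop :=
  exists N D, [/\ ev D != 0, x = tof N / tof D & v = ev N / ev D].

Lemma ev_neq0 p : ev p != 0 -> p != 0.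
Proof. by apply: contraNneq => ->; rewrite /ev rmorph0 horner0. Qed.

Lemma evD p r : ev (p + r) = ev p + ev r.
Proof. by rewrite /ev rmorphD hornerD. Qed.

Lemma evN p : ev (- p) = - ev p.
Proof. by rewrite /ev rmorphN hornerN. Qed.

Lemma evM p r : ev (p * r) = ev p * ev r.
Proof. by rewrite /ev rmorphM hornerM. Qed.

Lemma ev1 : ev 1 = 1.
Proof. by rewrite /ev rmorph1 hornerE. Qed.

Lemma tof_eq0 p : (tof p == 0) = (p == 0).
Proof. exact: tofrac_eq0. Qed.

Lemma spec_tof p : spec (tof p) (ev p).
Proof.
exists p, 1; rewrite ev1 oner_neq0 /tof tofrac1.
by split; rewrite ?divr1.
Qed.

Lemma spec_qq : spec qq w.
Proof. by have := spec_tof 'X; rewrite /ev map_polyX hornerX. Qed.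

Lemma spec1 : spec 1 1.
Proof. by have := spec_tof 1; rewrite ev1 /tof tofrac1. Qed.

Lemma specD x y v t : spec x v -> spec y t -> spec (x + y) (v + t).
Proof.
move=> [N [D [D0 -> ->]]] [N' [D' [D'0 -> ->]]].
exists (N * D' + N' * D), (D * D'); rewrite evD !evM mulf_neq0 //; split=> //.
  by rewrite addf_div ?tof_eq0 ?ev_neq0 // /tof tofracD !tofracM.
by rewrite addf_div.
Qed.

Lemma specN x v : spec x v -> spec (- x) (- v).
Proof.
move=> [N [D [D0 -> ->]]]; exists (- N), D; split=> //.
  by rewrite /tof tofracN mulNr.
by rewrite evN mulNr.
Qed.

Lemma specB x y v t : spec x v -> spec y t -> spec (x - y) (v - t).
Proof. by move=> sx sy; apply: specD sx (specN sy). Qed.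

Lemma specM x y v t : spec x v -> spec y t -> spec (x * y) (v * t).
Proof.
move=> [N [D [D0 -> ->]]] [N' [D' [D'0 -> ->]]].
exists (N * N'), (D * D'); rewrite !evM mulf_neq0 //; split=> //.
  by rewrite mulf_div /tof !tofracM.
by rewrite mulf_div.
Qed.

Lemma specV x v : spec x v -> v != 0 -> spec x^-1 v^-1.
Proof.
move=> [N [D [D0 -> ->]]]; rewrite mulf_eq0 invr_eq0 negb_or => /andP[N0 _].
by exists D, N; split; rewrite ?invf_div.
Qed.

Lemma spec_div x y v t : spec x v -> spec y t -> t != 0 -> spec (x / y) (v / t).
Proof. by move=> sx sy t0; apply: specM sx (specV sy t0). Qed.

Lemma specX x v k : spec x v -> spec (x ^+ k) (v ^+ k).
Proof.
by move=> sx; elim: k => [|k IHk]; [exact: spec1 | rewrite !exprS; apply: specM].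
Qed.

Lemma spec_sum n (f : nat -> RF) (g : nat -> algC) :
  (forall i, (i < n)%N -> spec (f i) (g i)) ->
  spec (\sum_(i < n) f i) (\sum_(i < n) g i).
Proof.
elim: n => [|n IHn] sf; last first.
  by rewrite !big_ord_recr; apply: specD (sf n _) => //; apply: IHn => i /ltnW/sf.
by have := spec_tof 0; rewrite !big_ord0 /tof tofrac0 /ev map_poly0 horner0.
Qed.

Lemma spec_prod n (f : nat -> RF) (g : nat -> algC) :
  (forall i, (i < n)%N -> spec (f i) (g i)) ->
  spec (\prod_(i < n) f i) (\prod_(i < n) g i).
Proof.
elim: n => [|n IHn] sf; first by rewrite !big_ord0; exact: spec1.
by rewrite !big_ord_recr; apply: specM (sf n _) => //; apply: IHn => i /ltnW/sf.
Qed.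

Lemma spec_qpoch a p v t k :
  spec a v -> spec p t -> spec (qpoch a p k) (qpoch v t k).
Proof.
move=> sa sp; apply: (spec_prod (f := fun j => 1 - a * p ^+ j)
  (g := fun j => 1 - v * t ^+ j)) => i _.
by apply: specB spec1 _; apply: specM sa _; apply: specX.
Qed.

(** Allows one rational function to be evaluated twice at [w], as a sum and as a closed product. *)
Lemma spec_inj x v t : spec x v -> spec x t -> v = t.
Proof.
move=> [N [D [D0 -> ->]]] [N' [D' [D'0 eqND ->]]].
apply/eqP; rewrite eqr_div // -!evM; apply/eqP; congr ev.
apply/eqP; move/eqP: eqND; rewrite eqr_div ?tof_eq0 ?ev_neq0 //.
by rewrite /tof -!tofracM tofrac_eq.
Qed.

End Specialization.

(** * Congruence modulo [Phi_n] as equality of values *)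

Lemma qq_neq0 : qq != 0.
Proof. by rewrite tof_eq0 polyX_eq0. Qed.

Lemma qqX_neq1 i : (0 < i)%N -> qq ^+ i != 1.
Proof.
move=> i_gt0; rewrite /qq /tof -tofracXn -tofrac1 tofrac_eq.
apply: contraTneq i_gt0 => /(congr1 (fun p : {poly rat} => size p)).
by rewrite size_polyXn size_poly1 => -[->].
Qed.

(** Over the rationals [Phi_n] is the minimal polynomial of [z]: a numerator vanishing at [z] is
    divisible by it, a denominator not vanishing there is coprime to it. *)
Lemma eqmodPhi_spec n z x y v : n.-primitive_root z ->
  spec z x v -> spec z y v -> eqmodPhi n x y.
Proof.
move=> z_prim sx sy.
have PhiE : map_poly (ratr : rat -> algC) (PhiQ n) = minCpoly z.
  rewrite (minCpoly_cyclotomic z_prim) -(Cintr_Cyclotomic z_prim) /PhiQ -map_poly_comp.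
  by apply: eq_map_poly => i /=; rewrite ratr_int.
have [P [PE P_monic] Pdvd] := minCpolyP z.
have P_Phi : PhiQ n = P.
  by apply: (map_poly_inj (@ratr algC : {rmorphism _ -> _})); rewrite PhiE PE.
have [N [D [D0 xyE]]] := specB sx sy.
rewrite subrr => /esym/eqP; rewrite mulf_eq0 invr_eq0 (negPf D0) orbF => N0.
exists N, D; split=> //; first exact: ev_neq0 D0.
(* [P = e * d] and [d] does not vanish at [z], so [e] does; then [P] divides [e], and [d] is
   constant for reasons of degree. *)
- rewrite P_Phi /coprimep; set d := gcdp D P.
  have d0 : ev z d != 0.
    apply: contraNneq D0 => d0; have /dvdpP[e ->] := dvdp_gcdl D P.
    by rewrite evM d0 mulr0.
  have /dvdpP[e eE] := dvdp_gcdr D P.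
  have : root (map_poly ratr (e * d)) z.
    by rewrite -eE -PE root_minCpoly.
  have P0 : P != 0 by rewrite monic_neq0.
  have e0 : e != 0 by apply: contraNneq P0 => e0; rewrite eE e0 mul0r.
  rewrite rmorphM rootM => /orP[|]; last by rewrite /root -[X in X == 0]/(ev z d) (negPf d0).
  rewrite Pdvd => /(dvdp_leq e0); rewrite eE size_mul // ?ev_neq0 //; last by apply: ev_neq0 d0.
  have := ev_neq0 d0; rewrite -size_poly_gt0 -/d.
  by case: (size d) => [|[|k]] // _; rewrite !addnS /= ltnNge leq_addr.
- by rewrite P_Phi -Pdvd.
Qed.

(** * Symmetrization at a root of unity *)

Lemma qpochS (F : comRingType) (a p : F) k :
  qpoch a p k.+1 = qpoch a p k * (1 - a * p ^+ k).
Proof. exact: big_ord_recr. Qed.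

(** Taken over any field, so that it can be read both at [qq] and at a root of unity. *)
Definition summand (F : fieldType) (z : F) (k : nat) : F :=
  (qpoch z (z ^+ 2) k ^+ 2 * qpoch (z ^+ 2) (z ^+ 4) k)
  / (qpoch (z ^+ 2) (z ^+ 2) k ^+ 2 * qpoch (z ^+ 4) (z ^+ 4) k) * (- z) ^+ k.

Definition summand_ratio (F : fieldType) (z : F) (k : nat) : F :=
  - z * ((1 - z ^+ (2 * k + 1)) ^+ 2 * (1 - z ^+ (4 * k + 2)))
  / ((1 - z ^+ (2 * k + 2)) ^+ 2 * (1 - z ^+ (4 * k + 4))).

Lemma summand_0 (F : fieldType) (z : F) : summand z 0 = 1.
Proof. by rewrite /summand /qpoch !big_ord0 !(expr1n, mulr1, divr1). Qed.

Lemma summand_S (F : fieldType) (z : F) k : summand z k.+1 = summand z k * summand_ratio z k.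
Proof.
rewrite /summand /summand_ratio !qpochS -!exprM -exprS -!exprD.
rewrite -[(2 * k).+1]addn1 [(2 + 2 * k)%N]addnC [(2 + 4 * k)%N]addnC [(4 + 4 * k)%N]addnC.
by rewrite !exprMn !invfM (exprS _ k); ring.
Qed.

Section RootOfUnity.
Variables (F : fieldType) (M : nat) (u : F).
Let n := (4 * M + 1)%N.
Hypothesis u_prim : n.-primitive_root u.

Lemma one_sub_uX i : ~~ (n %| i)%N -> 1 - u ^+ i != 0.
Proof. by rewrite (prim_order_dvd u_prim) subr_eq0 eq_sym. Qed.

(** As [n] is odd, [2^e] does not affect divisibility by [n]; only a bound on [j] remains to be
    checked. *)
Lemma one_sub_uX2 e i j : i = (j * 2 ^ e)%N -> (0 < j < n)%N -> 1 - u ^+ i != 0.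
Proof.
move=> -> /andP[j_gt0 lt_jn]; apply: one_sub_uX; rewrite Gauss_dvdl ?gtnNdvd //.
by rewrite coprimeXr // coprimen2 /n addn1 /= oddM.
Qed.

Lemma u_neq0 : u != 0.
Proof.
apply: contra_eq_neq (prim_expr_order u_prim) => ->.
by rewrite /n addn1 expr0n eq_sym oner_neq0.
Qed.

Lemma summand_neq0 k : (k <= 2 * M)%N -> summand (u ^+ 2) k != 0.
Proof.
elim: k => [|k IHk] lt_k; first by rewrite summand_0 oner_neq0.
rewrite summand_S mulf_neq0 ?IHk 1?ltnW // /summand_ratio -!exprM.
rewrite ?(mulf_neq0, invr_neq0, oppr_eq0, expf_neq0, u_neq0) //;
  first [apply: (@one_sub_uX2 1 _ (2 * k + 1)); rewrite /n; lia
     |apply: (@one_sub_uX2 2 _ (2 * k + 1)); rewrite /n; lia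
     |apply: (@one_sub_uX2 2 _ (k + 1)); rewrite /n; lia
     |apply: (@one_sub_uX2 3 _ (k + 1)); rewrite /n; lia].
Qed.

(** With [z = u^2], [a] stands for [z^(2k+1)] and [b] for its inverse, in the form [z^(n-2k-1)]. *)
Lemma summand_ratio_field (a b : F) : u != 0 ->
  a != 0 -> b != 0 -> a * b = 1 ->
  1 - a != 0 -> 1 - a * u ^+ 2 != 0 ->
  1 - a ^+ 2 != 0 -> 1 - (a * u ^+ 2) ^+ 2 != 0 ->
  - u ^+ 2 * ((1 - a) ^+ 2 * (1 - a ^+ 2))
     / ((1 - a * u ^+ 2) ^+ 2 * (1 - (a * u ^+ 2) ^+ 2)) *
  (- u ^+ 2 * ((1 - b / u ^+ 2) ^+ 2 * (1 - (b / u ^+ 2) ^+ 2))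
     / ((1 - b) ^+ 2 * (1 - b ^+ 2))) = (u ^+ 4)^-1.
Proof.
move=> u0 a0 b0 ab; have -> : b = a^-1 by rewrite -[b]mul1r -(mulVf a0) -mulrA ab mulr1.
move=> *; field.
by repeat (apply/andP; split) => //; rewrite -oppr_eq0 opprB.
Qed.

(** Passing from [k] to [2M-k-1] turns the exponents [2k+1] and [2k+2] of [z] into [n-(2k+2)] and
    [n-(2k+1)]; by [1 - 1/t = -(1-t)/t] all factors cancel up to a power of [u]. *)
Lemma summand_ratio_rev k : (k < 2 * M)%N ->
  summand_ratio (u ^+ 2) k * summand_ratio (u ^+ 2) (2 * M - k.+1) = (u ^+ 4)^-1.
Proof.
move=> lt_k; set a := u ^+ (4 * k + 2); set b := u ^+ (2 * n - (4 * k + 2)).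
have ab : a * b = 1.
  rewrite /a /b -exprD subnKC; last by rewrite /n; lia.
  by rewrite mulnC exprM (prim_expr_order u_prim) expr1n.
have a0 : a != 0 by rewrite expf_neq0 ?u_neq0.
have b0 : b != 0 by rewrite expf_neq0 ?u_neq0.
rewrite -(@summand_ratio_field a b u_neq0 a0 b0 ab).
- have bu : u ^+ (2 * n - (4 * k + 4)) = b / u ^+ 2.
    apply: (mulIf (expf_neq0 2 u_neq0)); rewrite divfK ?expf_neq0 ?u_neq0 //.
    by rewrite /b -exprD; congr (_ ^+ _); rewrite /n; lia.
  rewrite /summand_ratio -bu /a /b -!exprD -!exprM.
  by do ![congr (_ * _) | congr (_ - _) | congr (_ ^-1) | congr (_ ^+ _)]; rewrite /n; lia.
- by apply: (@one_sub_uX2 1 _ (2 * k + 1)); rewrite /n; lia.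
- by rewrite /a -exprD; apply: (@one_sub_uX2 2 _ (k + 1)); rewrite /n; lia.
- by rewrite /a -exprM; apply: (@one_sub_uX2 2 _ (2 * k + 1)); rewrite /n; lia.
- by rewrite /a -exprD -exprM; apply: (@one_sub_uX2 3 _ (k + 1)); rewrite /n; lia.
Qed.

Lemma summand_rev k : (k <= 2 * M)%N ->
  summand (u ^+ 2) (2 * M - k) = summand (u ^+ 2) k * u ^+ (4 * k + 1).
Proof.
(* Iterating the reflection of ratios from the last term gives the law up to the constant
   [t_(2M)]. *)
have rev j : (j <= 2 * M)%N ->
    summand (u ^+ 2) (2 * M - j) = summand (u ^+ 2) (2 * M) * (summand (u ^+ 2) j * u ^+ (4 * j)).
  elim: j => [|j IHj] lt_j; first by rewrite subn0 summand_0 muln0 !mulr1.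
  have := IHj (ltnW lt_j); rewrite -(subnSK lt_j) summand_S => eqj.
  have nz : summand_ratio (u ^+ 2) (2 * M - j.+1) != 0.
    apply/eqP => r0; have /esym/eqP := summand_ratio_rev lt_j.
    by rewrite r0 mulr0 invr_eq0 expf_eq0 (negPf u_neq0).
  apply: (mulIf nz); rewrite eqj summand_S.
  rewrite (_ : u ^+ (4 * j.+1) = u ^+ (4 * j) * u ^+ 4); last first.
    by rewrite -exprD; congr (_ ^+ _); lia.
  transitivity (summand (u ^+ 2) (2 * M) * (summand (u ^+ 2) j * u ^+ (4 * j))
     * (summand_ratio (u ^+ 2) j * summand_ratio (u ^+ 2) (2 * M - j.+1) * u ^+ 4)); last by ring.
  by rewrite summand_ratio_rev // mulVf ?mulr1 // expf_neq0 ?u_neq0.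
suff -> : forall k, u ^+ (4 * k + 1) = summand (u ^+ 2) (2 * M) * u ^+ (4 * k).
  by move=> le_k; rewrite rev //; ring.
(* The index [M] is its own mirror image: there the law reads [1 = t_(2M) u^(4M)], whence
   [t_(2M) = u]. *)
have le_M : (M <= 2 * M)%N by lia.
have := rev M le_M; rewrite (_ : 2 * M - M = M)%N; last by lia.
rewrite mulrCA -{1}[summand _ M]mulr1 => /(mulfI (summand_neq0 le_M)) eq1 j.
have -> : summand (u ^+ 2) (2 * M) = u; last by rewrite addn1 exprS.
apply: (mulIf (expf_neq0 (4 * M) u_neq0)).
by rewrite -eq1 -exprS -addn1 (prim_expr_order u_prim).
Qed.

(** At [q = u] one has [x = u^(2n) = 1], and the two factors containing [x] merge into a square. *)
Lemma summand_wterm k : (1 + u ^+ (4 * k + 1)) * summand (u ^+ 2) k = wterm u (u ^+ (8 * M + 2)) k.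
Proof.
have -> : u ^+ (8 * M + 2) = 1.
  by rewrite (_ : 8 * M + 2 = n * 2)%N ?exprM ?(prim_expr_order u_prim) ?expr1n // /n; lia.
rewrite /wterm -mulrA; congr (_ * _); elim: k => [|k IHk].
  by rewrite summand_0 /wprod big_ord0 mulr1.
rewrite summand_S IHk /wprod big_ord_recr /= (exprS _ k) /summand_ratio -!exprM !mul1r.
have -> : (2 * (2 * k + 1) = 4 * k + 2)%N by lia.
have -> : (2 * (4 * k + 2) = 8 * k + 4)%N by lia.
have -> : (2 * (2 * k + 2) = 4 * k + 4)%N by lia.
have -> : (2 * (4 * k + 4) = 8 * k + 8)%N by lia.
by rewrite !invfM; ring.
Qed.

Lemma wsum_summand : wsum u M = 2%:R * \sum_(k < 2 * M + 1) summand (u ^+ 2) k.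
Proof.
rewrite /wsum mulr_natl mulr2n.
rewrite [X in _ = X + _](reindex_inj rev_ord_inj) -big_split /=.
apply: eq_bigr => k _; have le_k : (k <= 2 * M)%N by have := ltn_ord k; lia.
rewrite -summand_wterm mulrDl mul1r addrC; congr (_ + _).
by rewrite mulrC -summand_rev //; congr summand; rewrite /=; lia.
Qed.

End RootOfUnity.

(** * Evaluation of the products *)

Lemma prod_fold (R : comNzRingType) (f : nat -> R) r :
  \prod_(i < r + r) f i = \prod_(i < r) (f (r - i.+1)%N * f (r + i)%N).
Proof.
rewrite big_split_ord big_split /=; congr (_ * _).
by rewrite (reindex_inj rev_ord_inj).
Qed.

Lemma prod_pairs (R : comNzRingType) (f : nat -> R) r :
  \prod_(i < r + r) f i = \prod_(i < r) (f (2 * i)%N * f (2 * i + 1)%N).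
Proof.
elim: r => [|r IHr]; first by rewrite !big_ord0.
rewrite addSn addnS !big_ord_recr /= IHr -mulrA; congr (_ * (f _ * f _)); lia.
Qed.

Section ProductsAtRoot.
Variables (F : fieldType) (r : nat) (u : F).
Let n := (8 * r + 1)%N.
Hypothesis u_prim : n.-primitive_root u.

Let u_prim4 : (4 * (2 * r) + 1).-primitive_root u.
Proof. by rewrite mulnA. Qed.

Let u_neq0 : u != 0 := u_neq0 u_prim4.

Lemma uX_sub a b : (a + b = n)%N -> u ^+ a = (u ^+ b)^-1.
Proof.
move=> abn; apply: (mulIf (expf_neq0 b u_neq0)).
by rewrite mulVf ?expf_neq0 // -exprD abn (prim_expr_order u_prim).
Qed.

Lemma uX_add a b : (a = n + b)%N -> u ^+ a = u ^+ b.
Proof. by move=> ->; rewrite exprD (prim_expr_order u_prim) mul1r. Qed.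

(** Used with [u^(8i+2)], [u^(8i+4)], [u^(8i+6)], [u^(8i+8)]. By [1 - 1/t = -(1-t)/t] the four signs
    cancel and the leftover monomial is [a d / (b c) = 1]. *)
Lemma fold_field (a b c d : F) :
   a != 0 -> b != 0 -> c != 0 -> d != 0 -> a * d = b * c ->
   1 - a != 0 -> 1 - c != 0 -> 1 - d != 0 ->
  (1 - c^-1) * (1 - b^-1) * ((1 - a) * (1 - b)) /
  ((1 - a^-1) * (1 - c)) / ((1 - d^-1) * (1 - d)) = (1 - b) ^+ 2 / (1 - d) ^+ 2.
Proof.
move=> a0 b0 c0 d0 abcd a1 c1 d1.
transitivity ((a * d) / (b * c) * ((1 - b) ^+ 2 / (1 - d) ^+ 2)).
  field; repeat (apply/andP; split) => //; by rewrite -oppr_eq0 opprB.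
by rewrite abcd divff ?mul1r // mulf_neq0.
Qed.

(** Factors are paired symmetrically about the middle; modulo [n] their exponents become [8i+2],
    [8i+4], [8i+6], [8i+8] or opposites of these. *)
Lemma wprod_root :
  \prod_(i < 2 * r) ((1 - u ^+ (8 * i + 3)) * (1 - u ^+ (8 * i + 5)))
  / (\prod_(i < 2 * r) (1 - u ^+ (8 * i + 7)))
  / (\prod_(i < r) ((1 - u ^+ (8 * (r - i.+1) + 1)) * (1 - u ^+ (8 * (r.+1 + i) + 1))))
  = \prod_(i < r) ((1 - u ^+ (8 * i + 4)) ^+ 2 / (1 - u ^+ (8 * i + 8)) ^+ 2).
Proof.
rewrite mul2n -addnn (prod_fold (fun i => (1 - u ^+ (8 * i + 3)) * (1 - u ^+ (8 * i + 5)))).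
rewrite (prod_fold (fun i => 1 - u ^+ (8 * i + 7))) -!prodf_div.
apply: eq_bigr => i _; have lt_i := ltn_ord i.
rewrite (@uX_sub (8 * (r - i.+1) + 3) (8 * i + 6)); last by rewrite /n; lia.
rewrite (@uX_sub (8 * (r - i.+1) + 5) (8 * i + 4)); last by rewrite /n; lia.
rewrite (@uX_add (8 * (r + i) + 3) (8 * i + 2)); last by rewrite /n; lia.
rewrite (@uX_add (8 * (r + i) + 5) (8 * i + 4)); last by rewrite /n; lia.
rewrite (@uX_sub (8 * (r - i.+1) + 7) (8 * i + 2)); last by rewrite /n; lia.
rewrite (@uX_add (8 * (r + i) + 7) (8 * i + 6)); last by rewrite /n; lia.
rewrite (@uX_sub (8 * (r - i.+1) + 1) (8 * i + 8)); last by rewrite /n; lia.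
rewrite (@uX_add (8 * (r.+1 + i) + 1) (8 * i + 8)); last by rewrite /n; lia.
apply: fold_field; rewrite ?expf_neq0 //.
- by rewrite -!exprD; congr (_ ^+ _); lia.
- by apply: (@one_sub_uX2 _ _ _ u_prim4 1 _ (4 * i + 1)); lia.
- by apply: (@one_sub_uX2 _ _ _ u_prim4 1 _ (4 * i + 3)); lia.
- by apply: (@one_sub_uX2 _ _ _ u_prim4 3 _ (i + 1)); lia.
Qed.

End ProductsAtRoot.

(** * The right-hand side at a primitive root *)

Section RightHandSide.
Variables (F : fieldType) (r : nat) (z : F).
Let n := (8 * r + 1)%N.
Hypothesis z_prim : n.-primitive_root z.

Let z_prim4 : (4 * (2 * r) + 1).-primitive_root z.
Proof. by rewrite mulnA. Qed.

Let z_neq0 : z != 0 := u_neq0 z_prim4.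

Let zX_neq1 i : (0 < i < n)%N -> 1 - z ^+ i != 0.
Proof. by move=> lt_i; apply: (@one_sub_uX2 _ _ _ z_prim4 0 _ i); lia. Qed.

Lemma prod_invX_odd k : \prod_(j < 2 * k) - (z ^+ (2 * j + 1))^-1 = (z ^+ (4 * k ^ 2))^-1.
Proof.
elim: k => [|k IHk]; first by rewrite big_ord0 muln0 expr0 invr1.
have -> : (2 * k.+1 = (2 * k).+2)%N by lia.
rewrite !big_ord_recr /= IHk -mulrA mulrNN -!invfM -!exprD; congr ((_ ^+ _)^-1); lia.
Qed.

(** Write [1 + t = (1 - t^2) / (1 - t)]. The even exponents above [4r] reflect to the odd ones below
    [4r], so the numerator repeats the denominator up to the monomials of [prod_invX_odd], whose
    exponents add up to [(2r)^2]. *)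
Lemma qpoch_opp_root : qpoch (- z) z (4 * r) = (z ^+ (4 * r ^ 2))^-1.
Proof.
have nz : \prod_(j < 4 * r) (1 - z ^+ (j + 1)) != 0.
  by apply/prodf_neq0 => j _; have := ltn_ord j => lt_j; apply: zX_neq1; rewrite /n; lia.
apply: (mulIf nz); rewrite /qpoch -big_split /=.
rewrite (eq_bigr (fun j : 'I__ => 1 - z ^+ (2 * j + 2))) => [|j _]; last first.
  have -> : z ^+ (2 * j + 2) = z ^+ (j + 1) * z ^+ (j + 1).
    by rewrite -exprD; congr (_ ^+ _); lia.
  by rewrite addn1 exprS; ring.
have -> : (4 * r = 2 * r + 2 * r)%N by lia.
rewrite (prod_fold (fun j => 1 - z ^+ (2 * j + 2))).
rewrite (prod_pairs (fun j => 1 - z ^+ (j + 1))).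
rewrite -prod_invX_odd -big_split /= (reindex_inj rev_ord_inj) /=.
apply: eq_bigr => j _; have lt_j := ltn_ord j.
have -> : (2 * (2 * r + (2 * r - j.+1)) + 2 = n - (2 * j + 1))%N by rewrite /n; lia.
rewrite (@uX_sub _ _ _ z_prim (n - (2 * j + 1)) (2 * j + 1)); last by rewrite subnK // /n; lia.
have -> : (2 * (2 * r - (2 * r - j.+1).+1) + 2 = 2 * j + 1 + 1)%N by lia.
by field; rewrite expf_neq0.
Qed.

Lemma qpoch_expE a b k : qpoch (z ^+ a) (z ^+ b) k = \prod_(i < k) (1 - z ^+ (b * i + a)).
Proof. by apply: eq_bigr => i _; rewrite -exprM -exprD addnC. Qed.

Lemma rhs_root :
  (qpoch z (z ^+ 4) r * qpoch (z ^+ 2) (z ^+ 4) r) ^+ 2 * qpoch (- z) z (4 * r)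
  / qpoch (z ^+ 4) (z ^+ 4) (2 * r) ^+ 2 * z ^- (16 * r ^ 2)
  = \prod_(i < r) ((1 - z ^+ (4 * i + 2)) ^+ 2 / (1 - z ^+ (4 * i + 4)) ^+ 2).
Proof.
have qz : qpoch z (z ^+ 4) r = \prod_(i < r) (1 - z ^+ (4 * i + 1)).
  by rewrite -[X in qpoch X]expr1 qpoch_expE.
rewrite qpoch_opp_root {}qz !qpoch_expE mul2n -addnn big_split_ord /=.
(* The upper half of [(z^4; z^4)_(2r)] has exponents [n - (4i+1)]: up to a monomial [K] it is
   [(z; z^4)_r], which cancels [A] in the numerator. *)
rewrite [X in _ / (_ * X) ^+ 2](reindex_inj rev_ord_inj) /=.
rewrite [X in _ / (_ * X) ^+ 2](eq_bigr (fun i : 'I__ =>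
  - (z ^+ (4 * i + 1))^-1 * (1 - z ^+ (4 * i + 1)))); last first.
  move=> i _; have lt_i := ltn_ord i.
  rewrite (@uX_sub _ _ _ z_prim (4 * (r + (r - i.+1)) + 4) (4 * i + 1)); last by rewrite /n; lia.
  by field; rewrite expf_neq0.
rewrite big_split prodf_div !prodrXl /=.
set A := \prod_(i < r) (1 - z ^+ (4 * i + 1)).
set B := \prod_(i < r) (1 - z ^+ (4 * i + 2)).
set D := \prod_(i < r) (1 - z ^+ (4 * i + 4)).
set K := \prod_(i < r) _.
have A0 : A != 0.
  by apply/prodf_neq0 => i _; have := ltn_ord i => ?; apply: zX_neq1; rewrite /n; lia.
have D0 : D != 0.
  by apply/prodf_neq0 => i _; have := ltn_ord i => ?; apply: zX_neq1; rewrite /n; lia.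
(* Up to sign [K] is [z^(-r(2r-1))]. All monomials together have exponent [2r + 16r^2 = 2r n], hence
   equal 1. *)
have KE : K ^+ 2 * z ^+ (4 * r ^ 2) = z ^+ (2 * r).
  rewrite /K; elim: (r) => [|k IHk]; first by rewrite big_ord0 !muln0 expr0 expr1n mulr1.
  rewrite big_ord_recr /= exprMn sqrrN exprVn.
  have -> : z ^+ (4 * k.+1 ^ 2) = z ^+ (4 * k ^ 2) * (z ^+ (4 * k + 1)) ^+ 2 * z ^+ 2.
    by rewrite -exprM -!exprD; congr (_ ^+ _); lia.
  have -> : z ^+ (2 * k.+1) = z ^+ (2 * k) * z ^+ 2 by rewrite -exprD; congr (_ ^+ _); lia.
  by rewrite -IHk; field; rewrite expf_neq0.
have z1 : z ^+ (2 * r) * z ^+ (16 * r ^ 2) = 1.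
  rewrite -exprD (_ : _ + _ = n * (2 * r))%N; last by rewrite /n; lia.
  by rewrite exprM (prim_expr_order z_prim) expr1n.
have K0 : K != 0.
  by apply/prodf_neq0 => i _; rewrite oppr_eq0 invr_eq0 expf_neq0.
transitivity (B ^+ 2 / D ^+ 2 / (K ^+ 2 * z ^+ (4 * r ^ 2) * z ^+ (16 * r ^ 2))).
  by field; rewrite A0 D0 K0 !expf_neq0.
by rewrite KE z1 divr1.
Qed.
End RightHandSide.

(** * The congruence *)

(** With [n = 8r+1], [1 - q^(2n) = (1 - q^n)(1 + q^n)], and [1 - q^n] is the middle factor of the
    denominator. It vanishes at the root of unity, so it is cancelled for generic [q]; the other
    factors are paired as in [wprod_root]. *)
Lemma wsumE_even (F : fieldType) (q : F) r : q != 0 -> (forall i, (0 < i)%N -> q ^+ i != 1) ->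
  wsum q (2 * r) = (1 + q ^+ (8 * r + 1)) *
  (\prod_(i < 2 * r) ((1 - q ^+ (8 * i + 3)) * (1 - q ^+ (8 * i + 5)))
  / (\prod_(i < 2 * r) (1 - q ^+ (8 * i + 7)))
  / (\prod_(i < r) ((1 - q ^+ (8 * (r - i.+1) + 1)) * (1 - q ^+ (8 * (r.+1 + i) + 1))))).
Proof.
move=> q_neq0 q_inf; rewrite wsumE //.
set A := \prod_(i < 2 * r) _; set B := \prod_(i < 2 * r) _.
have -> : \prod_(i < (2 * r).+1) (1 - q ^+ (8 * i + 1)) =
  (1 - q ^+ (8 * r + 1)) *
  (\prod_(i < r) ((1 - q ^+ (8 * (r - i.+1) + 1)) * (1 - q ^+ (8 * (r.+1 + i) + 1)))).
  rewrite mul2n -addnn -addSn big_split_ord big_ord_recr big_split /=.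
  rewrite [in RHS](reindex_inj rev_ord_inj) /= mulrCA !mulrA; congr (_ * _ * _).
  apply: eq_bigr => i _; have lt_i := ltn_ord i.
  by do ![congr (_ - _) | congr (_ ^+ _)]; lia.
have -> : q ^+ (8 * (2 * r) + 2) = q ^+ (8 * r + 1) * q ^+ (8 * r + 1).
  by rewrite -exprD; congr (_ ^+ _); lia.
have := one_sub_qX q_inf (ltn_addl (8 * r) (ltn0Sn 0)).
set t := q ^+ (8 * r + 1) => t1.
transitivity ((1 - t) / (1 - t) * ((1 + t) * (A / B / \prod_(i < r)
    ((1 - q ^+ (8 * (r - i.+1) + 1)) * (1 - q ^+ (8 * (r.+1 + i) + 1)))))).
  by rewrite !invfM; ring.
by rewrite divff ?mul1r.
Qed.

(** Links the generic sum, which [wsumE] evaluates, to the one at [u]. There [x = 1], and the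
    denominators [(1 - u^(8j+8)) (1 - u^(4j+4))^2], [j < 2M], are nonzero. *)
Lemma spec_wsum u M : (4 * M + 1).-primitive_root u -> spec u (wsum qq M) (wsum u M).
Proof.
move=> u_prim; have s_qX k : spec u (qq ^+ k) (u ^+ k) by apply: specX (spec_qq u).
apply: (spec_sum (f := wterm qq (qq ^+ (8 * M + 2)))
  (g := wterm u (u ^+ (8 * M + 2)))) => k lt_k.
apply: specM; last by apply: specX; apply: specN.
apply: specM; first by apply: specD (spec1 u) _.
pose F (K : fieldType) (q : K) j := (1 - q ^+ (8 * j + 4)) * (q ^+ (8 * M + 2) - q ^+ (4 * j + 2))
  * (1 - q ^+ (8 * M + 2) * q ^+ (4 * j + 2)) / ((1 - q ^+ (8 * j + 8)) *
    (q ^+ (8 * M + 2) - q ^+ (4 * j + 4)) * (1 - q ^+ (8 * M + 2) * q ^+ (4 * j + 4))).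
apply: (spec_prod (f := F RF qq) (g := F algC u)) => j lt_j.
have u1 : u ^+ (8 * M + 2) = 1.
  rewrite (_ : 8 * M + 2 = (4 * M + 1) * 2)%N; last by lia.
  by rewrite exprM (prim_expr_order u_prim) expr1n.
apply: spec_div; last rewrite u1 !mul1r.
- by do ![exact: spec1 | exact: s_qX | apply: specM | apply: specB].
- by do ![exact: spec1 | exact: s_qX | apply: specM | apply: specB].
by rewrite !mulf_neq0 //; [apply: (@one_sub_uX2 _ M u u_prim 3 _ (j + 1))
  | apply: (@one_sub_uX2 _ M u u_prim 2 _ (j + 1))
  | apply: (@one_sub_uX2 _ M u u_prim 2 _ (j + 1))]; lia.
Qed.

(** The denominators of the closed product have odd exponents below [2n], so only the exponent [n]
    could cause a pole. *)
Lemma ndvdn_odd_lt2 n a : odd a -> (0 < a < 2 * n)%N -> a != n -> ~~ (n %| a)%N.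
Proof.
move=> odd_a lt_a ne_an; apply/dvdnP => -[[|[|c]] a_def].
- by rewrite a_def in odd_a.
- by rewrite a_def mul1n eqxx in ne_an.
- by move: lt_a; rewrite a_def; nia.
Qed.

(** The factor [1 - q^(2n)] vanishes at [u], and no pole compensates it: the denominator exponents
    are 1 or 7 modulo 8, whereas [n] is 5. *)
Lemma wsum_root5 r (u : algC) : (8 * r + 5).-primitive_root u -> wsum u (2 * r + 1) = 0.
Proof.
move=> u_prim; have u_prim4 : (4 * (2 * r + 1) + 1).-primitive_root u.
  by rewrite (_ : 4 * _ + 1 = 8 * r + 5)%N //; lia.
have s_qX k : spec u (1 - qq ^+ k) (1 - u ^+ k).
  by apply: specB (spec1 u) _; apply: specX (spec_qq u).
have u1 : u ^+ (8 * (2 * r + 1) + 2) = 1.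
  rewrite (_ : _ + 2 = (8 * r + 5) * 2)%N; last by lia.
  by rewrite exprM (prim_expr_order u_prim) expr1n.
have := spec_wsum u_prim4; rewrite wsumE; [|exact: qq_neq0|exact: qqX_neq1].
rewrite -mulrA; set Y := (_ / _) => s_wsum.
suff [v s_v] : exists v, spec u Y v.
  by rewrite (spec_inj s_wsum (specM (s_qX _) s_v)) u1 subrr mul0r.
eexists; apply: spec_div.
- by apply: (spec_prod (f := fun i => (1 - qq ^+ (8 * i + 3)) * (1 - qq ^+ (8 * i + 5)))
    (g := fun i => (1 - u ^+ (8 * i + 3)) * (1 - u ^+ (8 * i + 5)))) => i _; apply: specM.
- apply: specM.
    by apply: (spec_prod (f := fun i => 1 - qq ^+ (8 * i + 7))
      (g := fun i => 1 - u ^+ (8 * i + 7))).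
  by apply: (spec_prod (f := fun i => 1 - qq ^+ (8 * i + 1)) (g := fun i => 1 - u ^+ (8 * i + 1))).
rewrite mulf_neq0 //; apply/prodf_neq0 => i _; have lt_i := ltn_ord i;
  by apply: (one_sub_uX u_prim4); apply: ndvdn_odd_lt2; lia.
Qed.

Lemma wsum_root1 r (u : algC) : (8 * r + 1).-primitive_root u ->
  wsum u (2 * r) = 2%:R * \prod_(i < r) ((1 - u ^+ (8 * i + 4)) ^+ 2 / (1 - u ^+ (8 * i + 8)) ^+ 2).
Proof.
move=> u_prim; have u_prim4 : (4 * (2 * r) + 1).-primitive_root u by rewrite mulnA.
have s_qX k : spec u (1 - qq ^+ k) (1 - u ^+ k).
  by apply: specB (spec1 u) _; apply: specX (spec_qq u).
have := spec_wsum u_prim4; rewrite wsumE_even; [|exact: qq_neq0|exact: qqX_neq1].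
move=> /spec_inj; apply; rewrite -(wprod_root u_prim).
apply: specM.
  (* The factor 2 is the value of [1 + q^n] at [u]. *)
  rewrite -[2%:R]/(1 + 1) -{2}(prim_expr_order u_prim).
  by apply: specD (spec1 u) _; apply: specX (spec_qq u).
do ![apply: spec_div].
- by apply: (spec_prod (f := fun i => (1 - qq ^+ (8 * i + 3)) * (1 - qq ^+ (8 * i + 5)))
    (g := fun i => (1 - u ^+ (8 * i + 3)) * (1 - u ^+ (8 * i + 5)))) => i _; apply: specM.
- by apply: (spec_prod (f := fun i => 1 - qq ^+ (8 * i + 7)) (g := fun i => 1 - u ^+ (8 * i + 7))).
- apply/prodf_neq0 => i _; have lt_i := ltn_ord i.
  by apply: (one_sub_uX u_prim4); apply: ndvdn_odd_lt2; lia.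
- by apply: (spec_prod (f := fun i => (1 - qq ^+ (8 * (r - i.+1) + 1))
      * (1 - qq ^+ (8 * (r.+1 + i) + 1)))
    (g := fun i => (1 - u ^+ (8 * (r - i.+1) + 1))
      * (1 - u ^+ (8 * (r.+1 + i) + 1)))) => i _; apply: specM.
- apply/prodf_neq0 => i _; have lt_i := ltn_ord i.
  by rewrite mulf_neq0 //; apply: (one_sub_uX u_prim4); apply: ndvdn_odd_lt2; lia.
Qed.

Lemma qpoch_root_neq0 M (z : algC) a k : (4 * M + 1).-primitive_root z ->
  (k <= 2 * M)%N -> (a == 2) || (a == 4)%N -> qpoch (z ^+ a) (z ^+ a) k != 0.
Proof.
move=> z_prim le_k a24; rewrite qpoch_expE; apply/prodf_neq0 => i _; have lt_i := ltn_ord i.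
by case/orP: a24 => /eqP->; [apply: (@one_sub_uX2 _ _ _ z_prim 1 _ (i + 1))
  | apply: (@one_sub_uX2 _ _ _ z_prim 2 _ (i + 1))]; lia.
Qed.

Theorem theorem5 (n : nat) :
  (0 < n)%N -> (n %% 4 = 1)%N ->
  eqmodPhi n
    (\sum_(0 <= k < ((n - 1) %/ 2).+1)
       (qpoch qq (qq ^+ 2) k ^+ 2 * qpoch (qq ^+ 2) (qq ^+ 4) k)
       / (qpoch (qq ^+ 2) (qq ^+ 2) k ^+ 2 * qpoch (qq ^+ 4) (qq ^+ 4) k)
       * (- qq) ^+ k)
    (if (n %% 8 == 1)%N then
       (qpoch qq (qq ^+ 4) ((n - 1) %/ 8) * qpoch (qq ^+ 2) (qq ^+ 4) ((n - 1) %/ 8)) ^+ 2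
       * qpoch (- qq) qq ((n - 1) %/ 2)
       / qpoch (qq ^+ 4) (qq ^+ 4) ((n - 1) %/ 4) ^+ 2
       * qq ^- ((n - 1) ^ 2 %/ 4)
     else 0).
Proof.
move=> n_gt0 n_mod4; have [u u_prim] := C_prim_root_exists n_gt0.
have [M nE] : exists M, n = (4 * M + 1)%N by exists (n %/ 4)%N; lia.
have u_prim4 : (4 * M + 1).-primitive_root u by rewrite -nE.
set z := u ^+ 2; have z_prim : n.-primitive_root z.
  by rewrite prim_root_exp_coprime // coprime2n nE addn1 /= oddM.
have z_prim4 : (4 * M + 1).-primitive_root z by rewrite -nE.
have s_qX k : spec z (qq ^+ k) (z ^+ k) by apply: specX (spec_qq z).
have s_lhs : spec z (\sum_(k < 2 * M + 1) summand qq k) (\sum_(k < 2 * M + 1) summand z k).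
  apply: spec_sum => k lt_k; apply: specM; last by apply: specX; apply: specN (spec_qq z).
  have le_k : (k <= 2 * M)%N by lia.
  apply: spec_div.
  - by apply: specM; [apply: specX|]; apply: spec_qpoch => //; apply: spec_qq.
  - by apply: specM; [apply: specX|]; apply: spec_qpoch.
  - by rewrite mulf_neq0 ?expf_neq0 // (qpoch_root_neq0 z_prim4 le_k).
rewrite big_mkord (_ : ((n - 1) %/ 2).+1 = 2 * M + 1)%N; last by lia.
apply: (eqmodPhi_spec z_prim s_lhs).
have two_neq0 : (2%:R : algC) != 0 by rewrite pnatr_eq0.
have := wsum_summand u_prim4; rewrite -/z.
case: ifP => [/eqP n_mod8 | /eqP n_mod8].
  have [r ME] : exists r, M = (2 * r)%N by exists (n %/ 8)%N; lia.
  have n8 : n = (8 * r + 1)%N by lia.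
  rewrite [in wsum _ _]ME wsum_root1 -?n8 // => /(mulfI two_neq0) <-.
  have -> : ((n - 1) %/ 8 = r)%N by lia.
  have -> : ((n - 1) %/ 2 = 4 * r)%N by lia.
  have -> : ((n - 1) %/ 4 = 2 * r)%N by lia.
  have -> : ((n - 1) ^ 2 %/ 4 = 16 * r ^ 2)%N.
    by rewrite (_ : (n - 1) ^ 2 = 16 * r ^ 2 * 4)%N ?mulnK // n8 addnK; lia.
  have z_prim8 : (8 * r + 1).-primitive_root z by rewrite -n8.
  have := rhs_root z_prim8.
  (* Both evaluations agree once the powers of [z] are read as even powers of [u]. *)
  rewrite (eq_bigr (fun i : 'I_r =>
    (1 - u ^+ (8 * i + 4)) ^+ 2 / (1 - u ^+ (8 * i + 8)) ^+ 2)) => [<-|i _]; last first.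
    have -> : (8 * i + 4 = 2 * (4 * i + 2))%N by lia.
    have -> : (8 * i + 8 = 2 * (4 * i + 4))%N by lia.
    by rewrite !(exprM u).
  apply: specM; last by apply: specV => //; rewrite expf_neq0 // (u_neq0 z_prim4).
  apply: spec_div.
  - apply: specM; last by apply: spec_qpoch; [apply: specN|]; apply: spec_qq.
    by apply: specX; apply: specM; apply: spec_qpoch => //; apply: spec_qq.
  - by apply: specX; apply: spec_qpoch.
  - by rewrite expf_neq0 // (qpoch_root_neq0 z_prim4) // -ME leq_pmull.
have [r ME] : exists r, M = (2 * r + 1)%N by exists (n %/ 8)%N; lia.
rewrite [in wsum _ _]ME wsum_root5; last by rewrite (_ : 8 * r + 5 = n)%N //; lia.
rewrite -(mulr0 2%:R) => /(mulfI two_neq0) <-.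
(* Zero is written [1 - 1] on both sides to obtain its value at [z]. *)
by rewrite -(subrr (1 : RF)) -(subrr (1 : algC)); apply: specB; apply: spec1.
Qed.
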